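(* Let $R=K[x_1,\ldots,x_n]$ be a polynomial ring over a field $K$, let $I\subset R$ be a normally torsion-free square-free monomial ideal, and let $h$ be a square-free monomial in $R$. Suppose there exist two variables $x_r,x_s$ with $1\leq r\neq s\leq n$ such that for every $u\in\mathcal{G}(I)$ one has $\gcd(h,u)=1$, or $\gcd(h,u)=x_r$, or $\gcd(h,u)=x_rx_s$. Then the ideal $I+hR$ is normally torsion-free, nearly normally torsion-free, normal, has the strong persistence property, has the persistence property, and has the symbolic strong persistence property.
   Context: $\mathcal{G}(I)$ denotes the unique minimal monomial generating set of a monomial ideal $I$. $\mathrm{Ass}(R/I)$ is the set of associated primes and $\mathrm{Min}(I)$ the set of minimal primes of $I$. An ideal $I$ is normally torsion-free if $\mathrm{Ass}(R/I^k)\subseteq\mathrm{Ass}(R/I)$ for all $k\geq1$. A monomial ideal $I$ is nearly normally torsion-free if there exist a positive integer $k$ and a monomial prime ideal $\mathfrak p$ such that $\mathrm{Ass}(R/I^m)=\mathrm{Min}(I)$ for all $1\leq m\leq k$ and $\mathrm{Ass}(R/I^m)\subseteq\mathrm{Min}(I)\cup\{\mathfrak p\}$ for all $m\geq k+1$. $I$ is normal if $\overline{I^k}=I^k$ for all $k\geq1$, where $\overline{J}$ is the integral closure of $J$. $I$ has the strong persistence property if $(I^{k+1}:I)=I^k$ for all $k\geq1$; the persistence property if $\mathrm{Ass}(R/I^k)\subseteq\mathrm{Ass}(R/I^{k+1})$ for all $k\geq1$; and the symbolic strong persistence property if $(I^{(k+1)}:I^{(1)})=I^{(k)}$ for all $k\geq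 1$, where $I^{(k)}$ is the $k$-th symbolic power (intersection of the primary components of $I^k$ belonging to the minimal primes of $I$). *)

(* Defs.v *)
From HB Require Import structures.
From mathcomp Require Import all_boot all_order all_algebra.
From mathcomp Require Import mpoly.
Set Implicit Arguments. Unset Strict Implicit. Unset Printing Implicit Defensive.
Import GRing.Theory.
Local Open Scope ring_scope.

Section Ideals.
Variable R : comRingType.

Definition is_ideal (I : R -> Prop) : Prop :=
  I 0 /\ (forall a b, I a -> I b -> I (a + b)) /\ (forall r a, I a -> I (r * a)).

Definition subid (I J : R -> Prop) : Prop := forall x, I x -> J x.
Definition eqid (I J : R -> Prop) : Prop := forall x, I x <-> J x.

Definition gen (S : R -> Prop) : R -> Prop :=
  fun f => forall J, is_ideal J -> subid S J -> J f.

Definition idsum (I J : R -> Prop) : R -> Prop := gen (fun f => I f \/ J f).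
Definition idmul (I J : R -> Prop) : R -> Prop :=
  gen (fun f => exists a b, I a /\ J b /\ f = a * b).
Definition idunit : R -> Prop := fun _ => True.
Fixpoint idpow (I : R -> Prop) (k : nat) : R -> Prop :=
  if k is k'.+1 then idmul (idpow I k') I else idunit.

Definition colon (I J : R -> Prop) : R -> Prop :=
  fun f => forall g, J g -> I (f * g).
Definition colon1 (I : R -> Prop) (f : R) : R -> Prop := fun g => I (g * f).

Definition is_prime (P : R -> Prop) : Prop :=
  is_ideal P /\ ~ P 1 /\ (forall a b, P (a * b) -> P a \/ P b).

Definition Ass (I : R -> Prop) (P : R -> Prop) : Prop :=
  is_prime P /\ exists f, eqid P (colon1 I f).

Definition Min (I : R -> Prop) (P : R -> Prop) : Prop :=
  is_prime P /\ subid I P /\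
  (forall Q, is_prime Q -> subid I Q -> subid Q P -> subid P Q).

Definition intclos (I : R -> Prop) : R -> Prop := fun f =>
  exists m : nat, exists a : nat -> R, (0 < m)%N /\
    (forall i, (1 <= i <= m)%N -> idpow I i (a i)) /\
    f ^+ m + \sum_(1 <= i < m.+1) a i * f ^+ (m - i) = 0.

(* k-th symbolic power: intersection of the components of I^k at the minimal
   primes P of I, the P-component being I^k R_P \cap R *)
Definition sympow (I : R -> Prop) (k : nat) : R -> Prop := fun f =>
  forall P, Min I P -> exists s, ~ P s /\ idpow I k (s * f).

Definition normally_torsion_free (I : R -> Prop) : Prop :=
  forall k, (1 <= k)%N -> forall P, Ass (idpow I k) P -> Ass I P.

Definition is_normal (I : R -> Prop) : Prop :=
  forall k, (1 <= k)%N -> eqid (intclos (idpow I k)) (idpow I k).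

Definition strong_persistence (I : R -> Prop) : Prop :=
  forall k, (1 <= k)%N -> eqid (colon (idpow I k.+1) I) (idpow I k).

Definition persistence (I : R -> Prop) : Prop :=
  forall k, (1 <= k)%N -> forall P, Ass (idpow I k) P -> Ass (idpow I k.+1) P.

Definition symbolic_strong_persistence (I : R -> Prop) : Prop :=
  forall k, (1 <= k)%N -> eqid (colon (sympow I k.+1) (sympow I 1)) (sympow I k).

End Ideals.

Section Monomial.
Variables (K : fieldType) (n : nat).
Local Notation R := {mpoly K[n]}.

Definition mono (m : 'X_{1..n}) : R := 'X_[m].

Definition mgcd (m1 m2 : 'X_{1..n}) : 'X_{1..n} :=
  [multinom minn (m1 i) (m2 i) | i < n].

Definition sqfree (m : 'X_{1..n}) : Prop := forall i, (m i <= 1)%N.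

Definition is_monomial_ideal (I : R -> Prop) : Prop :=
  exists S : 'X_{1..n} -> Prop, eqid I (gen (fun f => exists m, S m /\ f = mono m)).

Definition mingens (I : R -> Prop) (u : 'X_{1..n}) : Prop :=
  I (mono u) /\ forall v, (v <= u)%MM -> I (mono v) -> v = u.

Definition is_sqfree_monomial_ideal (I : R -> Prop) : Prop :=
  is_monomial_ideal I /\ forall u, mingens I u -> sqfree u.

Definition is_monomial_prime (P : R -> Prop) : Prop :=
  exists A : {set 'I_n}, eqid P (gen (fun f => exists i, i \in A /\ f = 'X_i)).

Definition nearly_normally_torsion_free (I : R -> Prop) : Prop :=
  exists k : nat, exists p : R -> Prop, (0 < k)%N /\ is_monomial_prime p /\
    (forall m, (1 <= m <= k)%N -> forall P, Ass (idpow I m) P <-> Min I P) /\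
    (forall m, (k.+1 <= m)%N -> forall P,
        Ass (idpow I m) P -> Min I P \/ eqid P p).

End Monomial.

(* Main.v *)
(* For a square-free monomial ideal I with edge set E = G(I), normal torsion-freeness is
   equivalent to I^k being the intersection of the P_C^k, C ranging over the minimal vertex
   covers of E, i.e. to: a monomial of degree at least k along every minimal cover is
   divisible by a product of k edges.  This min-max property passes from E to E + h: the
   gcd condition forces every minimal cover of E + h to meet h exactly once, so that factors
   h can be split off a monomial m until some variable of h is missing from m; adding this
   variable to a cover of E gives a cover of E + h of the same degree on m.  Once (I + hR)^k is the
   intersection of the P_C^k, everything follows because the order along P_C is a valuation. *)

Require Import Defs.
From HB Require Import structures.
From mathcomp Require Import all_boot all_order all_algebra.
From mathcomp Require Import mpoly zify.
From Stdlib Require Import Classical ClassicalEpsilon.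
Import GRing.Theory.
Set Implicit Arguments. Unset Strict Implicit. Unset Printing Implicit Defensive.
Local Open Scope ring_scope.

Lemma exists_finset (T : finType) (Q : T -> Prop) :
  exists A : {set T}, forall i, i \in A <-> Q i.
Proof.
exists [set i | if excluded_middle_informative (Q i) then true else false].
by move=> i; rewrite inE; case: excluded_middle_informative.
Qed.

#[local] Hint Resolve lepm_refl : core.

(** * Vertex covers of a clutter and products of edges *)

Section Clutter.
Variable n : nat.
Implicit Types (E : 'X_{1..n} -> Prop) (m u w h : 'X_{1..n}) (C D : {set 'I_n}).

Definition cdeg C m : nat := \sum_(i in C) m i.

Lemma cdegD C m u : cdeg C (m + u)%MM = (cdeg C m + cdeg C u)%N.
Proof. by rewrite /cdeg -big_split; apply: eq_bigr => i _; rewrite mnmDE. Qed.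

Lemma cdegB C m u : (u <= m)%MM -> cdeg C (m - u)%MM = (cdeg C m - cdeg C u)%N.
Proof. by move=> le_um; rewrite -{2}(submK le_um) cdegD addnK. Qed.

Lemma cdeg_le C m u : (u <= m)%MM -> (cdeg C u <= cdeg C m)%N.
Proof. by move/mnm_lepP => le_um; apply: leq_sum => i _. Qed.

Lemma cdeg_subset C D m : C \subset D -> (cdeg C m <= cdeg D m)%N.
Proof. by move=> sCD; rewrite /cdeg [leqRHS](big_setID C) (setIidPr sCD) leq_addr. Qed.

Lemma cdeg_setD1 C m i : i \in C -> cdeg C m = (m i + cdeg (C :\ i) m)%N.
Proof. by move=> iC; rewrite /cdeg (big_setD1 i). Qed.

Lemma cdeg_setU1 C m i : (cdeg (i |: C) m <= m i + cdeg C m)%N.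
Proof.
have [iC | niC] := boolP (i \in C); last by rewrite /cdeg big_setU1.
by rewrite (setUidPr _) ?sub1set // leq_addl.
Qed.

Lemma cdeg_ge C m i : i \in C -> (m i <= cdeg C m)%N.
Proof. by move=> /cdeg_setD1 ->; apply: leq_addr. Qed.

Lemma cdeg_gt0P C m : reflect (exists2 i, i \in C & 0 < m i)%N (0 < cdeg C m)%N.
Proof.
apply: (iffP idP) => [|[i iC mi]]; last exact: leq_trans (cdeg_ge _ iC).
rewrite lt0n sum_nat_eq0 negb_forall => /existsP[i].
by rewrite negb_imply -lt0n => /andP[iC mi]; exists i.
Qed.

Lemma cdeg_eq0P C m : reflect (forall i, i \in C -> m i = 0%N) (cdeg C m == 0%N).
Proof.
rewrite /cdeg sum_nat_eq0.
by apply: (iffP forall_inP) => m0 i /m0 => [/eqP | ->].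
Qed.

Lemma cdegU C i : i \in C -> cdeg C U_(i)%MM = 1%N.
Proof.
move=> iC; rewrite (cdeg_setD1 _ iC) mnm1E eqxx; congr S; apply/eqP/cdeg_eq0P => j.
by rewrite !inE mnm1E => /andP[/negPf]; rewrite eq_sym => ->.
Qed.

Definition vcover E C := forall u, E u -> (0 < cdeg C u)%N.

(** Minimality is encoded by private edges: each vertex of [C] lies on an edge that meets [C]
    nowhere else. These edges are the test monomials of the later arguments. *)
Definition mincover E C :=
  vcover E C /\ forall i, i \in C -> exists2 u, E u & cdeg (C :\ i) u = 0%N.

Lemma vcover_mincover E C : vcover E C -> exists2 D : {set 'I_n}, D \subset C & mincover E D.
Proof.
have [k] := ubnP #|C|; elim: k C => // k IHk C ltCk covC.
have [minC | /not_all_ex_not[i /(imply_to_and (i \in C))[iC notu]]] :=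
  classic (forall i, i \in C -> exists2 u, E u & cdeg (C :\ i) u = 0%N).
  by exists C.
have [||D sDC minD] := IHk (C :\ i).
- by rewrite (cardsD1 i) iC in ltCk.
- by move=> u Eu; rewrite lt0n; apply/eqP => u0; apply: notu; exists u.
by exists D => //; apply: subset_trans sDC (subsetDl _ _).
Qed.

Lemma mincover_witness E C i : mincover E C -> i \in C ->
  exists u, [/\ E u, (0 < u i)%N & cdeg (C :\ i) u = 0%N].
Proof.
move=> [covC minC] iC; have [u Eu u0] := minC i iC; exists u; split=> //.
by have:= covC u Eu; rewrite (cdeg_setD1 _ iC) u0 addn0.
Qed.

Lemma mincover_subset E C D : mincover E C -> vcover E D -> D \subset C -> D = C.
Proof.
move=> [_ minC] covD sDC; apply/eqP; rewrite eqEsubset sDC; apply/subsetP => i iC.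
apply: contraT => niD; have [u /covD Eu u0] := minC i iC.
suff /(cdeg_subset u): D \subset C :\ i by rewrite u0; lia.
by rewrite subsetD1 sDC.
Qed.

(* [mpow E k m]: the monomial m lies in the k-th power of the ideal generated by E. *)
Fixpoint mpow E k m : Prop :=
  if k is k'.+1 then exists u, [/\ E u, (u <= m)%MM & mpow E k' (m - u)%MM]
  else True.

Lemma mpow1 E m : mpow E 1 m <-> exists2 u, E u & (u <= m)%MM.
Proof. by split=> [[u []]|[u]]; exists u. Qed.

Lemma mpow_mono E k m w : (m <= w)%MM -> mpow E k m -> mpow E k w.
Proof.
elim: k m w => //= k IHk m w le_mw [u [Eu le_um muk]]; exists u; split=> //.
  exact: lepm_trans le_mw.
apply: IHk muk; apply/mnm_lepP => i; rewrite !mnmBE leq_sub2r //.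
exact/mnm_lepP.
Qed.

Lemma mpowM E k m w : mpow E k m -> mpow E 1 w -> mpow E k.+1 (m + w)%MM.
Proof.
move=> mk /mpow1[u Eu le_uw]; exists u; split=> //; last first.
  apply: mpow_mono mk; apply/mnm_lepP => i.
  by rewrite mnmBE mnmDE; move/mnm_lepP: le_uw => /(_ i); lia.
by apply/mnm_lepP => i; rewrite mnmDE; move/mnm_lepP: le_uw => /(_ i); lia.
Qed.

Lemma mpow_sub E F k m : (forall u, E u -> F u) -> mpow E k m -> mpow F k m.
Proof.
move=> sEF; elim: k m => //= k IHk m [u [/sEF Fu le_um /IHk]].
by exists u.
Qed.

Lemma mpow_cdeg E C k m : vcover E C -> mpow E k m -> (k <= cdeg C m)%N.
Proof.
move=> covC; elim: k m => //= k IHk m [u [/covC u0 le_um /IHk]].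
by rewrite cdegB //; have := cdeg_le C le_um; lia.
Qed.

(** A product of [k] square-free edges has all exponents at most [k], so the part of an exponent of
    [m] beyond [k] contributes nothing. *)
Lemma mpow_trunc E k m w : (forall u, E u -> sqfree u) ->
  (forall i, minn (m i) k <= w i)%N -> mpow E k m -> mpow E k w.
Proof.
move=> sqE; elim: k m w => //= k IHk m w le_mw [u [Eu le_um muk]]; exists u.
split=> //.
  apply/mnm_lepP => i; move/mnm_lepP: le_um => /(_ i).
  by have:= le_mw i; have:= sqE _ Eu i; lia.
apply: IHk muk => i; rewrite !mnmBE.
by have:= le_mw i; have:= sqE _ Eu i; lia.
Qed.

Lemma cdeg_le1 C i u : i \in C -> sqfree u -> cdeg (C :\ i) u = 0%N ->
  (cdeg C u <= 1)%N.
Proof. by move=> iC squ u0; rewrite (cdeg_setD1 _ iC) u0 addn0. Qed.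

(* The witnesses u_i of minimality, taken with multiplicity m_i (i in C), multiply to a
   monomial which is dominated by m on C, and off C as soon as m is large there. *)
Lemma mincover_mpow E C k m : (forall u, E u -> sqfree u) -> mincover E C ->
  (forall i, i \notin C -> k <= m i)%N -> (k <= cdeg C m)%N -> mpow E k m.
Proof.
move=> sqE minC; elim: k m => //= k IHk m mk ltk.
have /cdeg_gt0P[i iC mi] : (0 < cdeg C m)%N by lia.
have [u [Eu ui u0]] := mincover_witness minC iC.
have le_um : (u <= m)%MM.
  apply/mnm_lepP => j; have:= sqE u Eu j; have [<- | neq_ij] := eqVneq i j; first by lia.
  have [jC | njC] := boolP (j \in C); last by have:= mk j njC; lia.
  by rewrite (cdeg_eq0P _ _ (introT eqP u0)) // !inE eq_sym neq_ij.
exists u; split=> //; apply: IHk => [j njC|].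
  by have:= mk j njC; have:= sqE u Eu j; rewrite mnmBE; lia.
by rewrite cdegB //; have := cdeg_le1 iC (sqE u Eu) u0; lia.
Qed.

(* The exchange step: a minimal cover of E + h meets h exactly once, which lets one
   split off factors h until some variable of h is missing from m; that variable
   then extends every cover of E to a cover of E + h at no cost. *)
Lemma mpow_add_edge E h (F := fun u => E u \/ u = h) k m : sqfree h ->
    (forall k m, (forall C, mincover E C -> k <= cdeg C m)%N -> mpow E k m) ->
    (forall C, mincover E C -> cdeg C h <= 1)%N ->
    (forall C, mincover F C -> k <= cdeg C m)%N -> mpow F k m.
Proof.
move=> sqh ntfE hE; elim: k m => //= k IHk m leF.
have [le_hm | ] := boolP (h <= m)%MM.
  exists h; split=> //; [by right | apply: IHk => C minC].
  suff: (cdeg C h <= 1)%N by rewrite cdegB //; have:= leF C minC; lia.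
  (* If [h] is a private edge of some vertex of [C], it meets [C] only there. Otherwise all private
     edges come from [E], and [C] is already a minimal cover of [E]. *)
  have [[i iC h0] | noh] := classic (exists2 i, i \in C & cdeg (C :\ i) h = 0%N).
    exact: cdeg_le1 h0.
  apply: hE; split=> [u Eu|i iC]; first by apply: (minC.1); left.
  have [u [Eu | ->] u0] := minC.2 i iC; first by exists u.
  by case: noh; exists i.
move=> /mnm_lepP/not_all_ex_not[i /negP lt_mh].
apply: (@mpow_sub E F k.+1) => [u|]; first by left.
apply: ntfE => C minC.
have covF : vcover F (i |: C).
  move=> u [Eu | ->]; last by have := @cdeg_ge (i |: C) h i (setU11 _ _); lia.
  exact: leq_trans (minC.1 u Eu) (cdeg_subset _ (subsetUr _ _)).
have [D sDC minD] := vcover_mincover covF.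
have:= leF D minD; have:= leq_trans (cdeg_subset m sDC) (cdeg_setU1 C m i).
by have:= sqh i; move: (cdeg C m) (cdeg D m) => c d; lia.
Qed.

(* Elements of C that lie in h are r or s, and C cannot contain both: the edge witnessing
   that s is needed in C also passes through r. *)
Lemma mincover_cdeg_gcd E C h r s : (forall u, E u -> sqfree u) -> sqfree h ->
    (forall u, E u ->
     mgcd h u = 0%MM \/ mgcd h u = U_(r)%MM \/ mgcd h u = (U_(r) + U_(s))%MM) ->
  mincover E C -> (cdeg C h <= 1)%N.
Proof.
move=> sqE sqh gcdh minC.
have Ch i : i \in C -> (0 < h i)%N ->
    (i = r \/ i = s) /\ (r \in C -> i = r).
  move=> iC hi; have [u [Eu ui u0]] := mincover_witness minC iC.
  have gE j : minn (h j) (u j) = mgcd h u j by rewrite mnmE.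
  have gi := gE i; have gr := gE r.
  have rP : r \in C -> (0 < u r)%N -> i = r.
    move=> rC ur; apply/eqP; apply: contraLR ur => neq_ir.
    by rewrite (cdeg_eq0P _ _ (introT eqP u0)) // !inE eq_sym neq_ir.
  move: (gcdh u Eu) gi gr => [|[|]] ->; rewrite ?mnm0E ?mnmDE ?mnm1E ?eqxx.
  - by lia.
  - by case: (r =P i) => [-> | _] ; [auto | lia].
  - case: (r =P i) => [-> | _]; first by auto.
    by case: (s =P i) => [-> _ gr| _]; [split; [auto | move=> /rP ->//; lia] | lia].
have [h0 | /cdeg_gt0P[i iC hi]] := posnP (cdeg C h); first by rewrite h0.
apply: (@cdeg_le1 C i) => //; apply/eqP/cdeg_eq0P => j.
rewrite !inE => /andP[neq_ji jC]; apply/eqP; rewrite -leqn0 leqNgt.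
apply: contra neq_ji => hj.
have [[ir|is_] irC] := Ch i iC hi; have [[jr|js] jrC] := Ch j jC hj; apply/eqP.
- by rewrite ir jr.
- by rewrite jrC // -ir.
- by rewrite irC // -jr.
- by rewrite is_ js.
Qed.

End Clutter.

(** * Ideals, their powers and primes in a commutative ring *)

Section Ideals.
Variable R : comNzRingType.
Implicit Types (I J L P : R -> Prop) (S : R -> Prop).

Lemma ideal_sum I (T : eqType) (r : seq T) (F : T -> R) : is_ideal I ->
  (forall i, i \in r -> I (F i)) -> I (\sum_(i <- r) F i).
Proof.
move=> [I0 [ID _]] IF; rewrite big_seq; apply: (big_ind I) => // i; exact: IF.
Qed.

Lemma is_ideal_gen S : is_ideal (gen S).
Proof.
split; first by move=> J [J0 _] _.
split=> [a b Sa Sb J idJ sSJ | x a Sa J idJ sSJ].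
  by apply: idJ.2.1; [apply: Sa | apply: Sb].
by apply: idJ.2.2; apply: Sa.
Qed.

Lemma mem_gen S x : S x -> gen S x.
Proof. by move=> Sx J _; apply. Qed.

Lemma is_ideal_idpow I k : is_ideal (idpow I k).
Proof. by case: k => [|k]; [| apply: is_ideal_gen]. Qed.

Lemma mem_idmul I J a b : I a -> J b -> idmul I J (a * b).
Proof. by move=> Ia Jb; apply: mem_gen; exists a, b. Qed.

Lemma colon_idpow I k : subid (idpow I k) (colon (idpow I k.+1) I).
Proof. by move=> f If g Ig; apply: mem_idmul. Qed.

Lemma idpow1 I : is_ideal I -> eqid (idpow I 1) I.
Proof.
move=> idI f; split=> [If | If]; last by rewrite -[f]mul1r; apply: mem_idmul.
by apply: (If I) => // _ [a [b [_ [Ib ->]]]]; apply: idI.2.2.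
Qed.

Lemma Ass_eqid I J P : eqid I J -> Ass I P -> Ass J P.
Proof.
move=> eqIJ [prP [f Pf]]; split=> //; exists f => g.
by split=> [/Pf/eqIJ | /eqIJ/Pf].
Qed.

Lemma prime_eqid P Q : eqid P Q -> is_prime P -> is_prime Q.
Proof.
move=> e [[P0 [PD PM]] [P1 PP]]; split; last first.
  by split=> [/e | a b /e/PP[]/e]; [exact: P1 | left | right].
by split; [apply/e | split=> [a b /e Pa /e Pb | x a /e Pa]; apply/e; auto].
Qed.

Lemma prime_prod (T : Type) P (r : seq T) (F : T -> R) : is_prime P ->
  P (\prod_(i <- r) F i) -> exists i, P (F i).
Proof.
move=> [_ [P1 PM]]; elim: r => [|i r IHr]; rewrite ?big_nil ?big_cons // => /PM[] //.
by exists i.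
Qed.

Lemma prime_exp P x k : is_prime P -> P (x ^+ k) -> P x.
Proof.
move=> [_ [P1 PM]]; elim: k => [|k IHk]; rewrite ?expr0 // exprS => /PM[] //.
Qed.

End Ideals.

(** * Monomial ideals and their powers, tested term by term *)

Section MonomialIdeals.
Variables (K : fieldType) (n : nat).
Implicit Types (f g : {mpoly K[n]}) (m u w : 'X_{1..n}) (Q : 'X_{1..n} -> Prop).
Implicit Types (I J P : {mpoly K[n]} -> Prop).

(** For [Q] stable under multiples this is the monomial ideal whose monomials are those in [Q]. *)
Definition mono_span Q : {mpoly K[n]} -> Prop := fun f => forall m, m \in msupp f -> Q m.

Lemma mono_spanX Q m : mono_span Q 'X_[m] <-> Q m.
Proof.
split=> [|Qm w]; first by apply; rewrite msuppX inE.
by rewrite msuppX inE => /eqP->.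
Qed.

Lemma mono_spanD Q f g : mono_span Q f -> mono_span Q g -> mono_span Q (f + g).
Proof. by move=> Qf Qg m /msuppD_le; rewrite mem_cat => /orP[/Qf | /Qg]. Qed.

Lemma mono_spanM Q1 Q2 Q f g : (forall m w, Q1 m -> Q2 w -> Q (m + w)%MM) ->
  mono_span Q1 f -> mono_span Q2 g -> mono_span Q (f * g).
Proof.
by move=> QM Qf Qg m /msuppM_le/allpairsP[[u w] /= [/Qf Qu /Qg Qw ->]]; apply: QM.
Qed.

Lemma mono_span_ideal Q : (forall m w, Q w -> Q (m + w)%MM) -> is_ideal (mono_span Q).
Proof.
move=> QM; split; first by move=> m; rewrite msupp0.
split=> [f g | f g Qg]; first exact: mono_spanD.
by apply: (@mono_spanM (fun=> True) Q) => // m w _; apply: QM.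
Qed.

Lemma mem_ideal_mono I f : is_ideal I -> (forall m, m \in msupp f -> I 'X_[m]) -> I f.
Proof.
move=> idI If; rewrite [f]mpolyE; apply: ideal_sum => // m /If Im.
by rewrite -mul_mpolyC; apply: idI.2.2.
Qed.

Lemma mpolyX_dvd m u : (u <= m)%MM -> 'X_[m] = 'X_[m - u] * 'X_[u] :> {mpoly K[n]}.
Proof. by move=> le_um; rewrite -mpolyXD submK. Qed.

Lemma mem_idealX I m u : is_ideal I -> (u <= m)%MM -> I 'X_[u] -> I 'X_[m].
Proof. by move=> idI /mpolyX_dvd -> Iu; apply: idI.2.2. Qed.

Lemma mpow_ideal E k : is_ideal (mono_span (mpow E k)).
Proof.
apply: mono_span_ideal => m w; apply: mpow_mono.
by apply/mnm_lepP => i; rewrite mnmDE leq_addl.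
Qed.

Lemma gen_mono (S : 'X_{1..n} -> Prop) :
  eqid (gen (fun f => exists m, S m /\ f = mono K m)) (mono_span (mpow S 1)).
Proof.
move=> f; split=> [Sf | Sf].
  apply: Sf; first exact: mpow_ideal.
  by move=> _ [m [Sm ->]]; apply/mono_spanX/mpow1; exists m.
apply: mem_ideal_mono; first exact: is_ideal_gen.
move=> m /Sf/mpow1[u Su le_um]; apply: (mem_idealX (is_ideal_gen _) le_um).
by apply: mem_gen; exists u.
Qed.

Lemma idpow_mono I E k : eqid I (mono_span (mpow E 1)) ->
  eqid (idpow I k) (mono_span (mpow E k)).
Proof.
move=> eI; elim: k => [|k IHk] f; first by split.
split=> [If | Ef].
  apply: If; first exact: mpow_ideal.
  move=> _ [a [b [/IHk Ea [/eI Eb ->]]]].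
  by apply: mono_spanM Ea Eb => m w; apply: mpowM.
apply: mem_ideal_mono; first exact: is_ideal_gen.
move=> m /Ef[u [Eu le_um Em]]; rewrite (mpolyX_dvd le_um); apply: mem_idmul.
  exact/IHk/mono_spanX.
by apply/eI/mono_spanX/mpow1; exists u.
Qed.

Lemma mingens_dvd I m : I 'X_[m] -> exists2 u, mingens I u & (u <= m)%MM.
Proof.
have [k] := ubnP (mdeg m); elim: k m => // k IHk m ltmk Im.
have [minm | /not_all_ex_not[v]] := classic (forall v, (v <= m)%MM -> I 'X_[v] -> v = m).
  by exists m.
move=> vP; have [le_vm {}vP] := imply_to_and _ _ vP; have [Iv neq_vm] := imply_to_and _ _ vP.
have ltvk : (mdeg v < k)%N.
  rewrite -(submK le_vm) mdegD in ltmk.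
  suff: mdeg (m - v) != 0%N by lia.
  apply: contra_notN neq_vm; rewrite mdeg_eq0 => /eqP v0.
  by rewrite -[RHS](submK le_vm) v0 add0m.
have [u minu le_uv] := IHk v ltvk Iv.
by exists u => //; apply: lepm_trans le_vm.
Qed.

Lemma monomial_ideal_mingens I : is_monomial_ideal I ->
  eqid I (mono_span (mpow (mingens I) 1)).
Proof.
move=> [S eI]; have {}eI f : I f <-> mono_span (mpow S 1) f.
  by rewrite -gen_mono.
have idI : is_ideal I.
  have idS := mpow_ideal S 1; split; first by apply/eI; apply: idS.1.
  split=> [a b | x a]; rewrite !eI; [exact: idS.2.1 | exact: idS.2.2].
move=> f; split=> [/eI Sf m mf|If].
  apply/mpow1.
  apply: mingens_dvd.
  apply/eI.
  apply/mono_spanX.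
  exact: Sf.
apply: mem_ideal_mono => // m /If/mpow1[u [Iu _] /mem_idealX]; exact.
Qed.

End MonomialIdeals.

(** * The order along the prime generated by a set of variables *)

Section OrderAlongPrime.
Variables (K : fieldType) (n : nat).
Implicit Types (f g : {mpoly K[n]}) (m u w : 'X_{1..n}) (C D : {set 'I_n}).
Implicit Types (I J P : {mpoly K[n]} -> Prop).

(* [ordge C k] is the k-th power of the prime P_C generated by the variables in C;
   it is also its k-th symbolic power. *)
Definition ordge C k : {mpoly K[n]} -> Prop := mono_span (fun m => (k <= cdeg C m)%N).

Lemma ordge_ideal C k : is_ideal (ordge C k).
Proof. by apply: mono_span_ideal => m w; rewrite cdegD; lia. Qed.

Lemma ordgeX C k m : ordge C k 'X_[m] <-> (k <= cdeg C m)%N.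
Proof. exact: mono_spanX. Qed.

Lemma ordgeM C a b f g : ordge C a f -> ordge C b g -> ordge C (a + b) (f * g).
Proof. by apply: mono_spanM => m w; rewrite cdegD; apply: leq_add. Qed.

Lemma ordgeW C a b f : (b <= a)%N -> ordge C a f -> ordge C b f.
Proof. by move=> le_ba fa m /fa; apply: leq_trans. Qed.

Lemma ordge_exp C k (m : nat) f : ordge C k f -> ordge C (k * m) (f ^+ m).
Proof.
move=> fk; elim: m => [|m IHm]; first by rewrite muln0.
by rewrite exprS mulnS; apply: ordgeM.
Qed.

(* Multiplies each variable of C by a new indeterminate, which turns the order along P_C
   into the order of vanishing of a univariate polynomial over a domain. *)
Definition cgrade C : {mpoly K[n]} -> {poly {mpoly K[n]}} :=
  mmap (polyC \o @mpolyC n K) (fun i => ('X_i)%:P * (if i \in C then 'X else 1)).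

Lemma cgradeM C f g : cgrade C (f * g) = cgrade C f * cgrade C g.
Proof. by rewrite /cgrade rmorphM. Qed.

Lemma cgradeX C m : cgrade C 'X_[m] = 'X_[m]%:P * 'X^(cdeg C m).
Proof.
rewrite /cgrade mmapX /mmap1 mpolyXE_id rmorph_prod /=.
under eq_bigr => i _ do rewrite exprMn.
rewrite big_split /=; congr (_ * _); first by apply: eq_bigr => i _; rewrite rmorphXn.
rewrite /cdeg -prodrXr [RHS]big_mkcond; apply: eq_bigr => i _.
by case: ifP; rewrite ?expr1n.
Qed.

(** [cgrade C] records, as coefficients of one polynomial, the homogeneous components of [f] for the
    degree in the variables of [C]. *)
Lemma coef_cgrade C f d m :
  ((cgrade C f)`_d)@_m = if cdeg C m == d then f@_m else 0.
Proof.
elim/mpolyind: f => [|c w f _ _ IHf].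
  by rewrite /cgrade mmap0 coef0 !mcoeff0 if_same.
rewrite /cgrade mmapD mmapZ -!/(cgrade C _) cgradeX mulrA /= -rmorphM coefD coefCM coefXn.
rewrite mcoeffD IHf mcoeffD mcoeffZ !mcoeffX mul_mpolyC.
have [<- | neq_wm] := eqVneq w m.
  case: (eqVneq (cdeg C w) d) => [_ | neq_d] //=.
  - by rewrite !mulr1 mcoeffZ mcoeffX eqxx mulr1.
  - by rewrite mulr0 mcoeff0 addr0.
rewrite mulr_natr mcoeffMn mcoeffZ mcoeffX (negPf neq_wm) mulr0 mul0rn !add0r.
by case: ifP.
Qed.

Lemma ordge_coef C k f : ordge C k f <-> forall d, (d < k)%N -> (cgrade C f)`_d = 0.
Proof.
split=> [fk d ltdk | f0 m mf].
  apply/mpolyP => m; rewrite coef_cgrade mcoeff0; case: eqP => // eq_d.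
  by apply/eqP; rewrite mcoeff_eq0; apply/negP => /fk /=; rewrite eq_d leqNgt ltdk.
rewrite leqNgt; apply/negP => /f0 /(congr1 (mcoeff m)).
by rewrite coef_cgrade eqxx mcoeff0; apply/eqP; rewrite -mcoeff_msupp.
Qed.

Lemma coefM_lowest (A : nzRingType) (p q : {poly A}) a b :
    (forall d, (d < a)%N -> p`_d = 0) -> (forall d, (d < b)%N -> q`_d = 0) ->
  (p * q)`_(a + b) = p`_a * q`_b.
Proof.
move=> p0 q0; have lt_a : (a < (a + b).+1)%N by lia.
rewrite coefM (bigD1 (Ordinal lt_a)) //= addKn big1 ?addr0 // => i neq_ia.
have [/p0-> | lt_ai | eq_ia] := ltngtP i a; first by rewrite mul0r.
  by rewrite [q`_ _]q0 ?mulr0 //; have:= ltn_ord i; lia.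
by case/eqP: neq_ia; apply: val_inj.
Qed.

Lemma ordge_exact C k f : ~ ordge C k f ->
  exists2 a, (a < k)%N & ordge C a f /\ (cgrade C f)`_a != 0.
Proof.
move=> nfk; have exN : exists a, (cgrade C f)`_a != 0.
  apply: NNPP => no; apply/nfk/ordge_coef => d _; apply/eqP.
  by apply/negPn/negP => nz; apply: no; exists d.
have minN := ex_minnP exN; exists (ex_minn exN).
  case: minN => a nz mina; rewrite ltnNge; apply: contra_notN nfk => le_ka.
  apply/ordge_coef => d lt_dk; apply/eqP; apply: contraT => /mina; lia.
case: minN => a nz mina; split=> //; apply/ordge_coef => d lt_da.
by apply/eqP; apply: contraT => /mina; lia.
Qed.

(** The lowest coefficients of [cgrade C f] and [cgrade C g] have a nonzero product, the base ring
    being a domain, so orders add exactly. *)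
Lemma ordgeM_not C a b f g : ~ ordge C a.+1 f -> ~ ordge C b.+1 g ->
  ~ ordge C (a + b).+1 (f * g).
Proof.
move=> /ordge_exact[a' lta [/ordge_coef fa nza]] /ordge_exact[b' ltb [/ordge_coef gb nzb]].
move/ordge_coef/(_ (a' + b')%N); rewrite cgradeM coefM_lowest //.
by move=> H; have /eqP := H ltac:(lia); rewrite mulf_eq0 (negPf nza) (negPf nzb).
Qed.

Lemma ordgeX_not C a (m : nat) f : ~ ordge C a.+1 f -> ~ ordge C (a * m).+1 (f ^+ m).
Proof.
move=> nf; elim: m => [|m IHm]; last by rewrite exprS mulnS; apply: ordgeM_not.
move/(_ 0%MM); rewrite expr0 msupp1 inE eqxx => /(_ isT).
by rewrite muln0 (eqP (introT (cdeg_eq0P C 0%MM) _)) // => i _; rewrite mnm0E.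
Qed.

Lemma ordge_cancel C a b f g : ~ ordge C b.+1 g -> ordge C (a + b) (f * g) -> ordge C a f.
Proof.
move=> ng; case: a => [_ | a fg]; first by move=> m _.
by apply: NNPP => nf; apply: (ordgeM_not nf ng).
Qed.

Lemma ordge_prime C : is_prime (ordge C 1).
Proof.
split; first exact: ordge_ideal.
split=> [/(_ 0%MM) | f g fg].
  by rewrite msupp1 inE eqxx => /(_ isT) /cdeg_gt0P[i _]; rewrite mnm0E.
apply: NNPP => /not_or_and[nf ng]; exact: (ordgeM_not nf ng).
Qed.

Lemma ordge1_U C i : i \in C -> ordge C 1 'X_i.
Proof. by move=> iC; apply/ordgeX; rewrite cdegU. Qed.

Lemma ordge1_sub C P : is_ideal P -> (forall i, i \in C -> P 'X_i) -> subid (ordge C 1) P.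
Proof.
move=> idP CP f f1; apply: mem_ideal_mono => // m /f1/cdeg_gt0P[i iC mi].
apply: (mem_idealX idP _ (CP i iC)); apply/mnm_lepP => j.
by rewrite mnm1E; case: eqP => // <-.
Qed.

Lemma primeX P m : is_prime P -> P 'X_[m] -> exists2 i, (0 < m i)%N & P 'X_i.
Proof.
move=> prP; rewrite mpolyXE_id => /(prime_prod prP)[i].
have [-> | mi] := posnP (m i); first by rewrite expr0 => /prP.2.1.
by move=> /(prime_exp prP); exists i.
Qed.

End OrderAlongPrime.

(** * From normal torsion-freeness to the min-max property *)

Section Mengerian.
Variables (K : fieldType) (n : nat) (E : 'X_{1..n} -> Prop).
Variable I : {mpoly K[n]} -> Prop.
Hypothesis sqE : forall u, E u -> sqfree u.
Hypothesis eI : eqid I (mono_span (mpow E 1)).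
Implicit Types (f g : {mpoly K[n]}) (m u w : 'X_{1..n}) (C D : {set 'I_n}).
Implicit Types (P : {mpoly K[n]} -> Prop).

(* The minimal covers C enumerate the minimal primes P_C of I, so this says that the
   ordinary powers of I contain its symbolic powers. *)
Definition mengerian := forall k m,
  (forall C, mincover E C -> k <= cdeg C m)%N -> mpow E k m.

Lemma span_ideal : is_ideal I.
Proof.
have idE := mpow_ideal K E 1; split; first by apply/eI; apply: idE.1.
split=> [a b | x a]; rewrite !eI; [exact: idE.2.1 | exact: idE.2.2].
Qed.

Lemma edge_mem u : E u -> I 'X_[u].
Proof. by move=> Eu; apply/eI/mono_spanX/mpow1; exists u. Qed.

(** If P_C = (I : f), some term [t] of [f] lies outside I, while [t] times any variable of [C] lies
    in I. As edges are square-free, [t] involves no variable of [C], so an edge dividing [t] times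
    x_i is private to [i]. *)
Lemma Ass_mincover C : Ass I (ordge C 1) -> mincover E C.
Proof.
move=> [prC [f Cf]].
have [t tf nt] : exists2 t, t \in msupp f & ~ mpow E 1 t.
  apply: NNPP => no; case: (ordge_prime K C) => _ [+ _]; apply.
  apply/Cf; rewrite /colon1 mul1r; apply/eI => t tf.
  by apply: NNPP => nt; apply: no; exists t.
have tU i : i \in C -> mpow E 1 (t + U_(i))%MM.
  move=> /(ordge1_U (K := K))/Cf; rewrite /colon1 mulrC => /eI; apply.
  by rewrite (perm_mem (msuppMX _ _)) addmC map_f.
have t0 i : i \in C -> t i = 0%N.
  move=> /tU/mpow1[u Eu /mnm_lepP le_ut]; apply/eqP; rewrite -leqn0 leqNgt.
  apply/negP => ti; apply/nt/mpow1; exists u => //; apply/mnm_lepP => j.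
  have:= le_ut j; have:= sqE Eu j; rewrite mnmDE mnm1E; case: eqP => [<-|_]; lia.
split=> [u Eu | i iC].
  apply/ordgeX/Cf; rewrite /colon1 mulrC.
  exact/span_ideal.2.2/edge_mem.
have /mpow1[u Eu /mnm_lepP le_ut] := tU i iC; exists u => //.
apply/eqP/cdeg_eq0P => j; rewrite !inE => /andP[neq_ji jC].
by have:= le_ut j; rewrite mnmDE mnm1E t0 // eq_sym (negPf neq_ji); lia.
Qed.

(* A monomial w outside the k-th power, maximal in the box [m, m + k], has
   (I^k : w) = P_C for C the set of variables in which w lies inside the box: in the
   other variables w has exponent at least k, beyond which the power does not look. *)
Lemma box_colon k m : ~ mpow E k m ->
  exists w C, [/\ ~ mpow E k w, (m <= w)%MM, forall i, i \notin C -> (k <= w i)%N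
    & eqid (ordge C 1) (colon1 (idpow I k) 'X_[w])].
Proof.
move=> nm; pose inbox w := ~ mpow E k w /\ forall i, (m i <= w i <= m i + k)%N.
have [w [[nw box] maxw]] : exists w, inbox w /\
    forall i, ~ inbox (w + U_(i))%MM.
  (* Without a maximal [w], the box would contain monomials of arbitrarily large degree. *)
  apply: NNPP => no; have grow d : exists2 w, inbox w & (d <= mdeg w)%N.
    elim: d => [|d [w bw le_dw]].
      by exists m => //; split=> // i; rewrite leqnn leq_addr.
    have [i bi] : exists i, inbox (w + U_(i))%MM.
      by apply: NNPP => no'; apply: no; exists w; split=> // i bi; apply: no'; exists i.
    by exists (w + U_(i))%MM; rewrite // mdegD mdeg1; lia.
  have [w [_ box]] := grow (\sum_i (m i + k)).+1; rewrite mdegE ltnNge => /negP; apply.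
  by apply: leq_sum => i _; case/andP: (box i).
pose C := [set i | (w i < m i + k)%N].
have kC i : i \notin C -> (k <= w i)%N by rewrite inE -leqNgt; apply: leq_trans; lia.
exists w, C; split=> //; first by apply/mnm_lepP => i; case/andP: (box i).
move=> g; rewrite /colon1 (idpow_mono k eI); split=> [g1 q|gw q qg].
  rewrite (perm_mem (msuppMX _ _)) => /mapP[v /g1/cdeg_gt0P[i iC vi] ->].
  have: mpow E k (w + U_(i))%MM.
    apply: NNPP => ni; apply: (maxw i); split=> // j.
    move: (box j) iC; rewrite mnmDE mnm1E inE; case: eqP => [<-|_]; lia.
  apply: mpow_mono; apply/mnm_lepP => j; rewrite !mnmDE mnm1E.
  case: eqP => [<-|_]; lia.
rewrite lt0n; apply/negP => /cdeg_eq0P q0; apply: nw.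
have: mpow E k (w + q)%MM by apply: gw; rewrite (perm_mem (msuppMX _ _)) map_f.
apply: mpow_trunc => // i; rewrite mnmDE; have [iC | /kC] := boolP (i \in C); last by lia.
by rewrite q0 //; lia.
Qed.

(** For a counterexample [m], [box_colon] gives [w] outside the power with P_C associated to that
    power, hence to I, so [C] is a minimal cover. As [w] is large off [C] and of sufficient degree
    along [C], [mincover_mpow] puts it in the power after all. *)
Lemma ntf_mengerian : normally_torsion_free I -> mengerian.
Proof.
move=> ntf [|k] m leC; first by [].
apply: NNPP => /box_colon[w [C [nw le_mw kC eqC]]]; apply: nw.
have minC : mincover E C.
  apply: Ass_mincover; apply: (ntf k.+1) => //; split; first exact: ordge_prime.
  by exists 'X_[w].
apply: (mincover_mpow sqE minC kC).
exact: leq_trans (leC C minC) (cdeg_le _ le_mw).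
Qed.

(** * Consequences of the min-max property *)

Hypothesis mengE : mengerian.

Lemma idpow_ordge k f : idpow I k f <-> forall C, mincover E C -> ordge C k f.
Proof.
rewrite (idpow_mono k eI); split=> [Ef C minC m /Ef | Cf m mf].
  by apply: mpow_cdeg; case: minC.
by apply: mengE => C minC; apply: Cf.
Qed.

(** Let P = (I^k : f). Some minimal cover [C] has its variables in P and [f] outside P_C^k:
    otherwise the product of the k-th powers of the variables outside P would multiply [f] into
    every P_C^k, hence lie in P. Then P_C is contained in P, and cancelling [f] gives the
    converse. *)
Lemma Ass_idpow k P : Ass (idpow I k) P -> exists2 C, mincover E C & eqid P (ordge C 1).
Proof.
move=> [prP [f Pf]]; have [A inA] := exists_finset (fun i => ~ P 'X_i).
have PA : P (\prod_(i in A) 'X_i ^+ k) ->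
    exists2 C, mincover E C & eqid P (ordge C 1).
  rewrite big_mkcond => /(prime_prod prP)[i]; case: ifP => [/inA nPi | _ /prP.2.1 //].
  by move/(prime_exp prP)/nPi.
have [[C minC [nCf CP]] | no] := classic (exists2 C, mincover E C &
    ~ ordge C k f /\ forall i, i \in C -> P 'X_i).
  exists C => // g; split=> [/Pf/idpow_ordge/(_ C minC) gf|]; last first.
    exact: ordge1_sub prP.1 CP _.
  case: k nCf gf {Pf PA} => [[] //| k nCf gf].
  by apply: (ordge_cancel nCf); rewrite add1n.
apply: PA; apply/Pf/idpow_ordge => C minC.
have [Cf | nCf] := classic (ordge C k f); first exact: (ordge_ideal _ _ _).2.2.
have [i iC nPi] : exists2 i, i \in C & ~ P 'X_i.
  apply: NNPP => no'; apply: no; exists C => //; split=> // i iC.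
  by apply: NNPP => nPi; apply: no'; exists i.
rewrite (bigD1 i) ?inA //= -mulrA mulrC; apply: (ordge_ideal _ _ _).2.2.
by rewrite -[X in ordge C X]mul1n; apply: ordge_exp; apply: ordge1_U.
Qed.

Lemma mincover_Ass_idpow k C : (0 < k)%N -> mincover E C -> Ass (idpow I k) (ordge C 1).
Proof.
move=> k_gt0 minC; split; first exact: ordge_prime.
(* P_C = (I^k : w) for the monomial w of order k - 1 along C and at least k along every
   other minimal cover; for C empty, I = 0 and any w will do. *)
have [w [wk wD]] : exists w, ((cdeg C w = k.-1) \/ C = set0) /\
    forall D, mincover E D -> D <> C -> (k <= cdeg D w)%N.
  pose v : 'X_{1..n} := [multinom if i \in C then 0%N else k | i < n].
  have vC : cdeg C v = 0%N by apply/eqP/cdeg_eq0P => i iC; rewrite mnmE iC.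
  have vD D : mincover E D -> D <> C -> (k <= cdeg D v)%N.
    move=> minD neqDC; have /subsetPn[i iD niC] : ~~ (D \subset C).
      by apply/negP => /(mincover_subset minC minD.1).
    by apply: leq_trans (cdeg_ge _ iD); rewrite mnmE (negPf niC).
  have [C0 | [i iC]] := set_0Vmem C.
    by exists v; split; [right | ].
  exists (v + U_(i) *+ k.-1)%MM; split; last first.
    by move=> D /vD{}vD /vD; rewrite cdegD; lia.
  left; rewrite cdegD vC add0n; elim: (k.-1) => [|d IHd].
    by apply/eqP/cdeg_eq0P => j _; rewrite mulm0n mnm0E.
  by rewrite mulmS cdegD IHd cdegU.
exists 'X_[w] => g; rewrite /colon1 idpow_ordge.
have gC : ordge C k (g * 'X_[w]) <-> ordge C 1 g.
  case: wk => [wk | C0].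
    have nw : ~ ordge C (k.-1).+1 ('X_[w] : {mpoly K[n]}) by move/ordgeX; lia.
    split=> [gw | g1]; first by apply: (ordge_cancel nw); rewrite add1n prednK.
    by rewrite -[k]prednK // -add1n; apply: ordgeM => //; apply/ordgeX; lia.
  have set0_ordge a f : ordge C a.+1 f <-> f = 0.
    split=> [f0 | ->]; last by move=> m; rewrite msupp0.
    apply/eqP; rewrite -msupp_eq0; move: f0; rewrite /ordge /mono_span.
    case: (msupp f) => // m s /(_ m).
    by rewrite mem_head /cdeg C0 big_set0 => /(_ isT).
  rewrite -[k]prednK // !set0_ordge; split=> [/eqP | ->]; last by rewrite mul0r.
  by rewrite mulf_eq0 -[_ == 0]msupp_eq0 -[X in _ || X]msupp_eq0 msuppX orbF msupp_eq0 => /eqP.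
split=> [/gC gw D minD | ]; last by move=> /(_ C minC)/gC.
have [-> // | neqDC] := eqVneq D C; apply: (ordge_ideal _ _ _).2.2.
by apply/ordgeX/wD => //; apply/eqP.
Qed.

(** A prime Q between I and P_C contains a variable of the private edge of each [i] in [C]; lying in
    P_C as well, this variable is x_i. *)
Lemma mincover_Min C P : mincover E C -> eqid P (ordge C 1) -> Min I P.
Proof.
move=> minC eP; split; first by apply: prime_eqid (ordge_prime K C) => f; split=> /eP.
have idI := idpow1 span_ideal; split=> [f /idI/idpow_ordge/(_ C minC)/eP // | Q prQ IQ QP].
move=> f /eP; apply: ordge1_sub prQ.1 _ _ => i iC.
have [u [Eu ui u0]] := mincover_witness minC iC.
have [j uj Qj] := primeX prQ (IQ _ (edge_mem Eu)).
have jC : j \in C by have/QP/eP/ordgeX/cdeg_gt0P[l lC] := Qj;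
  rewrite mnm1E; case: eqP => // -> _.
suff /eqP <- : j == i by [].
apply: contraLR uj => neq_ji; rewrite (cdeg_eq0P _ _ (introT eqP u0)) //.
by rewrite !inE neq_ji.
Qed.

(** The variables in the prime P cover every edge. A minimal cover [C] among them gives a prime P_C
    between I and P, and minimality of P forces equality. *)
Lemma Min_mincover P : Min I P -> exists2 C, mincover E C & eqid P (ordge C 1).
Proof.
move=> [prP [IP minP]]; have [A inA] := exists_finset (fun i => P 'X_i).
have covA : vcover E A.
  move=> u /edge_mem/IP/(primeX prP)[i ui /inA iA].
  by apply/cdeg_gt0P; exists i.
have [C sCA minC] := vcover_mincover covA; exists C => // f.
have CP : subid (ordge C 1) P.
  by apply: ordge1_sub prP.1 _ => i /(subsetP sCA)/inA.
split; last exact: CP.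
apply: minP CP f; first exact: ordge_prime.
by move=> g /(idpow1 span_ideal)/idpow_ordge; apply.
Qed.

Lemma AssE k P : (0 < k)%N -> Ass (idpow I k) P <-> Min I P.
Proof.
move=> k_gt0; split=> [/Ass_idpow[C minC] | /Min_mincover[C minC eP]].
  exact: mincover_Min.
have [prC [f Cf]] := mincover_Ass_idpow k_gt0 minC.
split; first by apply: prime_eqid prC => g; split=> /eP.
by exists f => g; rewrite eP; apply: Cf.
Qed.

Lemma mengerian_ntf : normally_torsion_free I.
Proof.
move=> k k_gt0 P /AssE-/(_ k_gt0) /(AssE _ (ltn0Sn 0)).
exact/Ass_eqid/idpow1/span_ideal.
Qed.

Lemma mengerian_nntf : nearly_normally_torsion_free I.
Proof.
(* The zero ideal can serve as the extra prime, since Ass(R/I^m) = Min(I) holds for every positive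
   m. *)
exists 1%N, (gen (fun f => exists i, i \in set0 /\ f = 'X_i)).
split=> //; split; first by exists set0.
split=> [k /andP[k_gt0 _] P | k k_gt1 P]; first exact: AssE.
by move/AssE; left; auto.
Qed.

Lemma mengerian_persistence : persistence I.
Proof. by move=> k k_gt0 P /AssE-/(_ k_gt0)/AssE; apply. Qed.

Lemma idpow_idpow_ordge C k i f : mincover E C ->
  idpow (idpow I k) i f -> ordge C (k * i) f.
Proof.
move=> minC; elim: i f => [|i IHi] f If; first by rewrite muln0 => m _.
apply: If; first exact: ordge_ideal.
move=> _ [a [b [/IHi ai [/idpow_ordge bk ->]]]].
by rewrite mulnS addnC; apply: ordgeM ai (bk C minC).
Qed.

Lemma mengerian_normal : is_normal I.
Proof.
move=> k k_gt0 f; split=> [[m [a [m_gt0 [Ia eq0]]]] | If]; last first.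
  (* An element [f] of I^k is a root of T - f, an integral equation of degree one. *)
  exists 1%N, (fun=> - f); split=> //; split=> [i i1|].
    have -> : i = 1%N by lia.
    apply/(idpow1 (is_ideal_idpow I k)); rewrite -mulN1r.
    exact: (is_ideal_idpow I k).2.2.
  by rewrite big_nat1 expr1 subnn expr0 mulr1 subrr.
apply/idpow_ordge => C minC; apply: NNPP => nf.
(* If f has order exactly c < k along C, then in the integral equation f^m has order
   exactly c m, while the other terms have order at least k i + c (m - i) > c m. *)
have [c lt_ck [fc nzc]] := ordge_exact nf.
have nfc : ~ ordge C c.+1 f by move/ordge_coef/(_ c (ltnSn c))/eqP; apply/negP.
apply: (ordgeX_not (m := m) nfc).
have idC := ordge_ideal K C (c * m).+1.
move/eqP: eq0; rewrite addr_eq0 => /eqP ->; rewrite -mulN1r; apply: idC.2.2.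
apply: ideal_sum idC _ => i; rewrite mem_index_iota => /andP[i_gt0 le_im].
have /(idpow_idpow_ordge minC) ai := Ia i (introT andP (conj i_gt0 le_im)).
by move: (ordgeM ai (ordge_exp (m := (m - i)%N) fc)); apply: ordgeW; nia.
Qed.

(** A multiplier outside P_C has order 0 along P_C, so cancelling it leaves [f] of order at least
    [k] along every minimal cover. *)
Lemma sympow_idpow k : eqid (sympow I k) (idpow I k).
Proof.
move=> f; split=> [If | If P [[_ [P1 _]] _]]; last by exists 1; rewrite mul1r.
apply/idpow_ordge => C minC.
have [|x [nx /idpow_ordge/(_ C minC)]] := If (ordge C 1).
  by apply: (mincover_Min minC).
by move=> xf; apply: (ordge_cancel nx); rewrite addn0 mulrC.
Qed.

Hypothesis neE : exists u, E u.

(** A private edge of a vertex of [C] lies in I and has order exactly 1 along P_C, so cancelling it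
    lowers the order from [k.+1] to [k]. An edge must exist: otherwise I = 0 and (0 : 0) = R. *)
Lemma mengerian_strong_persistence : strong_persistence I.
Proof.
move=> k k_gt0 f; split=> [If | ]; last exact: colon_idpow.
apply/idpow_ordge => C minC.
have [i iC] : exists i, i \in C.
  by have [u /(minC.1)/cdeg_gt0P[i iC]] := neE; exists i.
have [u [Eu ui u0]] := mincover_witness minC iC.
have nu : ~ ordge C 2 ('X_[u] : {mpoly K[n]}).
  by move/ordgeX; have := cdeg_le1 iC (sqE Eu) u0; lia.
apply: (ordge_cancel nu); rewrite addn1.
by have /idpow_ordge/(_ C minC) := If _ (edge_mem Eu).
Qed.

Lemma mengerian_symbolic_strong_persistence : symbolic_strong_persistence I.
Proof.
move=> k k_gt0 f; rewrite sympow_idpow -(mengerian_strong_persistence k_gt0).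
have I1 := idpow1 span_ideal.
split=> If g Ig; apply/sympow_idpow; apply: If; first exact/sympow_idpow/I1.
exact/I1/sympow_idpow.
Qed.

End Mengerian.

(** * Adding the generator [h] *)

Lemma idsum_mono (K : fieldType) n (E : 'X_{1..n} -> Prop) (I : {mpoly K[n]} -> Prop) h :
  eqid I (mono_span (mpow E 1)) ->
  eqid (idsum I (gen (fun f => f = 'X_[h])))
       (mono_span (mpow (fun u => E u \/ u = h) 1)).
Proof.
move=> eI f; split=> [If | Ef].
  apply: If; first exact: mpow_ideal.
  move=> g [/eI Eg m /Eg | hg].
    by apply: mpow_sub => u; left.
  apply: hg; first exact: mpow_ideal.
  by move=> _ ->; apply/mono_spanX/mpow1; exists h => //; right.
apply: mem_ideal_mono; first exact: is_ideal_gen.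
move=> m /Ef/mpow1[u Fu le_um]; apply: (mem_idealX (is_ideal_gen _) le_um).
apply: mem_gen; case: Fu => [Eu | ->]; [left | right; exact: mem_gen].
by apply/eI/mono_spanX/mpow1; exists u.
Qed.

Theorem theorem2p3 (K : fieldType) (n : nat) (I : {mpoly K[n]} -> Prop)
  (h : 'X_{1..n}) (r s : 'I_n) :
  is_sqfree_monomial_ideal I ->
  normally_torsion_free I ->
  sqfree h ->
  r != s ->
  (forall u, mingens I u ->
     mgcd h u = 0%MM \/ mgcd h u = mnm1 r \/ mgcd h u = (mnm1 r + mnm1 s)%MM) ->
  let J := idsum I (gen (fun f => f = 'X_[h])) in
  normally_torsion_free J /\ nearly_normally_torsion_free J /\ is_normal J /\
  strong_persistence J /\ persistence J /\ symbolic_strong_persistence J.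
Proof.
move=> [monI sqI] ntfI sqh neq_rs gcdh J.
have eI := monomial_ideal_mingens monI.
(* [F] may be redundant, as [h] can divide a generator of I or be divided by one; the min-max
   argument asks only for a square-free generating set. *)
pose F u := mingens I u \/ u = h.
have eJ : eqid J (mono_span (mpow F 1)) := idsum_mono h eI.
have sqF u : F u -> sqfree u by case=> [/sqI | ->].
have mengF : mengerian F.
  move=> k m leF; apply: (mpow_add_edge sqh _ _ leF); first exact: ntf_mengerian ntfI.
  by move=> C; apply: mincover_cdeg_gcd gcdh.
have neF : exists u, F u by exists h; right.
split; first exact: mengerian_ntf eJ mengF.
split; first exact: mengerian_nntf eJ mengF.
split; first exact: mengerian_normal eJ mengF.
split; first exact: mengerian_strong_persistence eJ mengF neF.
split; first exact: mengerian_persistence eJ mengF.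
exact: mengerian_symbolic_strong_persistence eJ mengF neF.
Qed.
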